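(* Consider the condensed optimal control problem $\min_U V(x(0),U)$ s.t. $G(x(0),U)\le 0$ described in the context, with the constraints ordered so that the $q_{\mathcal{U}}$ half-space constraints representing $u(0)\in\mathcal{U}$ appear first, i.e. $G_{\{1,\dots,q_{\mathcal{U}}\}}(x(0),U)=\tilde G\,u(0)-\tilde w$ with $\tilde G\in\mathbb{R}^{q_{\mathcal{U}}\times m}$, $\tilde w\in\mathbb{R}^{q_{\mathcal{U}}}$. Let $\mathcal{A}$ be an arbitrary active set that exists for this problem, and let $\tilde{\mathcal{A}}:=\mathcal{A}\cap\{1,\dots,q_{\mathcal{U}}\}$. If $|\tilde{\mathcal{A}}|=m$ and $\tilde G_{\tilde{\mathcal{A}}}$ has full rank, then $$u^\star=\tilde G_{\tilde{\mathcal{A}}}^{-1}\,\tilde w_{\tilde{\mathcal{A}}}$$ is the optimal feedback law for all $x\in\Gamma(\mathcal{A})$, i.e. $u^\star(x)=\tilde G_{\tilde{\mathcal{A}}}^{-1}\,\tilde w_{\tilde{\mathcal{A}}}$ for all $x\in\Gamma(\mathcal{A})$, where $$\Gamma(\mathcal{A})=\bigcup_{\mathcal{A}'\in\mathcal{M}(\mathcal{A})}\mathcal{R}(\mathcal{A}'),\qquad \mathcal{M}(\mathcal{A})=\left\{\mathcal{A}'\subseteq\{1,\dots,q\}\;\middle|\;\mathcal{A}'\cap\{1,\dots,q_{\mathcal{U}}\}=\mathcal{A}\cap\{1,\dots,q_{\mathcal{U}}\}\right\}.$$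
   Context: Let $f:\mathbb{R}^n\times\mathbb{R}^m\to\mathbb{R}^n$ be twice continuously differentiable with $f(0,0)=0$. Let $\mathcal{U}\subseteq\mathbb{R}^m$ and $\mathcal{X}\subseteq\mathbb{R}^n$ be compact full-dimensional polytopes containing the origin in their interiors, let $\mathcal{T}\subseteq\mathcal{X}$ be a terminal set described by finitely many inequalities with differentiable constraint functions, let $N\in\mathbb{N}$ with $N\ge 1$, and let $Q,P\in\mathbb{R}^{n\times n}$, $R\in\mathbb{R}^{m\times m}$ be positive definite. The set $\mathcal{U}$ is given as the intersection of $q_{\mathcal{U}}$ closed half-spaces, $\mathcal{U}=\{v\in\mathbb{R}^m\mid \tilde G v\le\tilde w\}$. The optimal control problem, for a given initial state $x(0)$, is to minimize $$x(N)^TPx(N)+\sum_{k=0}^{N-1}\left(x(k)^TQx(k)+u(k)^TRu(k)\right)$$ over $u(0),\dots,u(N-1)$ and $x(1),\dots,x(N)$, subject to $x(k+1)=f(x(k),u(k))$, $u(k)\in\mathcal{U}$, $x(k)\in\mathcal{X}$ for $k=0,\dots,N-1$, and $x(N)\in\mathcal{T}$. Let $q$ be the total number of scalar inequality constraints. Put $U=(u(0)^T,\dots,u(N-1)^T)^T\in\mathbb{R}^{Nm}$. Eliminating $x(1),\dots,x(N)$ by recursively substituting $x(k+1)=f(x(k),u(k))$ yields the condensed problem $\min_U V(x(0),U)$ s.t. $G(x(0),U)\le 0$, where $V$ is real-valued and $G=(G_1,\dots,G_q)^T$ takes values in $\mathbb{R}^q$; each row of $G$ corresponds to one scalar inequality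 constraint, in the same order. For a matrix or vector $M$ and an index set $\mathcal{M}$, $M_{\mathcal{M}}$ denotes the rows of $M$ with indices in $\mathcal{M}$. Inequalities between vectors are componentwise. KKT conditions: $\nabla_U\left(V(x(0),U)+\sum_{i=1}^q\lambda_iG_i(x(0),U)\right)=0$, and $\lambda_iG_i(x(0),U)=0$, $G_i(x(0),U)\le 0$, $\lambda_i\ge 0$ for $i=1,\dots,q$, with multipliers $\lambda\in\mathbb{R}^q$. Let $\mathcal{F}$ be the set of $x(0)$ for which the KKT conditions have a solution. For $x(0)\in\mathcal{F}$ the solution of the KKT conditions is assumed to be unique and is denoted $(U^\star(x(0)),\lambda^\star(x(0)))$; $U^\star(x(0))$ is called the optimal control law. The optimal feedback law is its first input, $u^\star(x(0)):=U^\star_{\{1,\dots,m\}}(x(0))\in\mathbb{R}^m$. For $x(0)\in\mathcal{F}$ the optimal active set is $\mathcal{A}(x(0))=\{i\in\{1,\dots,q\}\mid G_i(x(0),U^\star(x(0)))=0\}$. An active set $\mathcal{A}\subseteq\{1,\dots,q\}$ is said to exist for the problem if $\mathcal{A}=\mathcal{A}(x(0))$ for some $x(0)\in\mathcal{F}$. For $\mathcal{A}'\subseteq\{1,\dots,q\}$ with complement $\mathcal{I}'=\{1,\dots,q\}\setminus\mathcal{A}'$, the region $\mathcal{R}(\mathcal{A}')$ is the set of all $x(0)\in\mathbb{R}^n$ for which there is $(U,\lambda)\in\mathbb{R}^{Nm}\times\mathbb{R}^q$ satisfying the equalities $$\nabla_U\Big(V(x(0),U)+\sum_{i\in\mathcal{A}'}\lambda_iG_i(x(0),U)\Big)=0,\quad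 G_{\mathcal{A}'}(x(0),U)=0,\quad \lambda_{\mathcal{I}'}=0$$ and the strict inequalities $$G_{\mathcal{I}'}(x(0),U)<0,\quad -\lambda_{\mathcal{A}'}<0 .$$ *)

(* Defs.v *)
(* MathComp-Analysis, over an arbitrary R : realType; R^k is 'cV[R]_k. *)
From HB Require Import structures.
From mathcomp Require Import all_boot all_order all_algebra.
From mathcomp Require Import all_classical all_reals all_analysis.

Set Implicit Arguments.
Unset Strict Implicit.
Unset Printing Implicit Defensive.
Import Order.TTheory GRing.Theory Num.Theory.
Import numFieldNormedType.Exports.

Local Open Scope classical_set_scope.
Local Open Scope ring_scope.

(* On finite-dimensional spaces this is the usual class C^k, since
   f is C^(k+1) iff it is differentiable with C^k directional derivatives. *)
Fixpoint Ck (R : realType) (V W : normedModType R) (k : nat) (f : V -> W)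
    : Prop :=
  if k is k'.+1 then
    (forall x, differentiable f x) /\ (forall v, Ck k' (fun x => 'D_v f x))
  else continuous f.

Definition grad (R : realType) (d : nat) (F : 'cV[R]_d -> R) (z : 'cV[R]_d)
    : 'cV[R]_d :=
  \col_i 'D_(delta_mx i 0) F z.

Definition quad (R : realType) (d : nat) (M : 'M[R]_d) (x : 'cV[R]_d) : R :=
  (x^T *m M *m x) 0 0.

(* Symmetry is not required. *)
Definition posdef (R : realType) (d : nat) (M : 'M[R]_d) : Prop :=
  forall x : 'cV[R]_d, x != 0 -> 0 < quad M x.

(* The rows of M with indices in S, in increasing order. *)
Definition subrows (R : realType) (q d : nat) (S : {set 'I_q})
    (M : 'M[R]_(q, d)) : 'M[R]_(#|S|, d) :=
  rowsub (fun i : 'I_#|S| => enum_val i) M.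

Definition hpoly (R : realType) (q d : nat) (H : 'M[R]_(q, d)) (b : 'cV[R]_q)
    : set 'cV[R]_d :=
  [set v | forall i, (H *m v) i 0 <= b i 0].

(* {v | H v <= b} is a compact polytope with the origin in its interior (hence
   full-dimensional); nonzero rows make every inequality a half-space. *)
Definition polytope_at0 (R : realType) (q d : nat) (H : 'M[R]_(q, d))
    (b : 'cV[R]_q) : Prop :=
  [/\ forall i, row i H != 0, compact (hpoly H b) & interior (hpoly H b) 0].

(* Horizon N; qU, qX half-spaces for the input and state sets, qT
   inequalities for the terminal set. *)
Record ocp (R : realType) (n m N qU qX qT : nat) := Ocp {
  dyn : 'cV[R]_n * 'cV[R]_m -> 'cV[R]_n;
  Qw : 'M[R]_n;
  Pw : 'M[R]_n;
  Rw : 'M[R]_m;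
  GU : 'M[R]_(qU, m);
  wU : 'cV[R]_qU;
  GX : 'M[R]_(qX, n);
  wX : 'cV[R]_qX;
  hT : 'I_qT -> 'cV[R]_n -> R }.

Definition Uset (R : realType) (n m N qU qX qT : nat)
    (p : ocp R n m N qU qX qT) : set 'cV[R]_m := hpoly (GU p) (wU p).

Definition Xset (R : realType) (n m N qU qX qT : nat)
    (p : ocp R n m N qU qX qT) : set 'cV[R]_n := hpoly (GX p) (wX p).

Definition Tset (R : realType) (n m N qU qX qT : nat)
    (p : ocp R n m N qU qX qT) : set 'cV[R]_n :=
  [set x | forall i, hT p i x <= 0].

Record ocp_ok (R : realType) (n m N qU qX qT : nat)
    (p : ocp R n m N qU qX qT) : Prop := OcpOk {
  dyn_C2 : Ck 2 (dyn p);
  dyn0 : dyn p (0, 0) = 0;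
  Uset_ok : polytope_at0 (GU p) (wU p);
  Xset_ok : polytope_at0 (GX p) (wX p);
  hT_diff : forall i x, differentiable (hT p i) x;
  Tset_sub : Tset p `<=` Xset p;
  Qw_posdef : posdef (Qw p);
  Pw_posdef : posdef (Pw p);
  Rw_posdef : posdef (Rw p) }.

(* The scalar constraints: row i of u(k) in U, row i of x(k) in X, and
   inequality i of x(N) in T. *)
Inductive constr (N qU qX qT : nat) :=
  | InputC of 'I_N & 'I_qU
  | StateC of 'I_N & 'I_qX
  | TermC of 'I_qT.

Arguments InputC {N qU qX qT}.
Arguments StateC {N qU qX qT}.
Arguments TermC {N qU qX qT}.

(* u(k): mxvec_index k j has value k * m + j, so U stacks u(0), u(1), ... *)
Definition input (R : realType) (m N : nat) (U : 'cV[R]_(N * m)) (k : 'I_N)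
    : 'cV[R]_m :=
  \col_j U (mxvec_index k j) 0.

Section Condensed.
Context (R : realType) (n m N qU qX qT q : nat).

(* The horizon N.+1 ranges over all integers >= 1. *)
Variable p : ocp R n m N.+1 qU qX qT.

(* Used only for k <= N.+1, so inord is applied only within its range. *)
Fixpoint state (x0 : 'cV[R]_n) (U : 'cV[R]_(N.+1 * m)) (k : nat) : 'cV[R]_n :=
  if k is k'.+1 then dyn p (state x0 U k', input U (inord k')) else x0.

Definition Vcost (x0 : 'cV[R]_n) (U : 'cV[R]_(N.+1 * m)) : R :=
  quad (Pw p) (state x0 U N.+1) +
  \sum_(k < N.+1) (quad (Qw p) (state x0 U k) + quad (Rw p) (input U k)).

Definition constr_val (x0 : 'cV[R]_n) (U : 'cV[R]_(N.+1 * m))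
    (c : constr N.+1 qU qX qT) : R :=
  match c with
  | InputC k i => (GU p *m input U k - wU p) i 0
  | StateC k i => (GX p *m state x0 U k - wX p) i 0
  | TermC i => hT p i (state x0 U N.+1)
  end.

(* c enumerates the constraints, i.e. fixes the order of the rows of G. *)
Variable c : 'I_q -> constr N.+1 qU qX qT.

Definition Gcon (x0 : 'cV[R]_n) (U : 'cV[R]_(N.+1 * m)) : 'cV[R]_q :=
  \col_i constr_val x0 U (c i).

Definition KKT (x0 : 'cV[R]_n) (U : 'cV[R]_(N.+1 * m)) (l : 'cV[R]_q) : Prop :=
  grad (fun z => Vcost x0 z + \sum_(i < q) l i 0 * Gcon x0 z i 0) U = 0 /\
  forall i, [/\ l i 0 * Gcon x0 U i 0 = 0, Gcon x0 U i 0 <= 0 & 0 <= l i 0].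

Definition KKTset (x0 : 'cV[R]_n) : set ('cV[R]_(N.+1 * m) * 'cV[R]_q) :=
  [set z | KKT x0 z.1 z.2].

Definition Fset : set 'cV[R]_n := [set x0 | KKTset x0 !=set0].

Definition KKT_unique : Prop := forall x0, Fset x0 -> is_subset1 (KKTset x0).

(* The KKT solution; meaningful only on Fset, under KKT_unique. *)
Definition KKTsol (x0 : 'cV[R]_n) : 'cV[R]_(N.+1 * m) * 'cV[R]_q :=
  xget (0, 0) (KKTset x0).

Definition Ustar (x0 : 'cV[R]_n) : 'cV[R]_(N.+1 * m) := (KKTsol x0).1.

Definition ustar (x0 : 'cV[R]_n) : 'cV[R]_m := input (Ustar x0) ord0.

Definition active_set (x0 : 'cV[R]_n) : {set 'I_q} :=
  [set i | Gcon x0 (Ustar x0) i 0 == 0]%SET.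

Definition exists_active (A : {set 'I_q}) : Prop :=
  exists x0, Fset x0 /\ A = active_set x0.

Definition region (A : {set 'I_q}) : set 'cV[R]_n :=
  [set x0 | exists (U : 'cV[R]_(N.+1 * m)) (l : 'cV[R]_q),
    [/\ grad (fun z => Vcost x0 z + \sum_(i in A) l i 0 * Gcon x0 z i 0) U = 0,
        forall i, i \in A -> Gcon x0 U i 0 = 0,
        forall i, i \notin A -> l i 0 = 0,
        forall i, i \notin A -> Gcon x0 U i 0 < 0 &
        forall i, i \in A -> - l i 0 < 0]].

Definition first_rows : {set 'I_q} := [set i : 'I_q | (i < qU)%N]%SET.

Definition Mfam (A : {set 'I_q}) : set {set 'I_q} :=
  [set A' | A' :&: first_rows = A :&: first_rows].

Definition Gamma (A : {set 'I_q}) : set 'cV[R]_n :=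
  \bigcup_(A' in Mfam A) region A'.

End Condensed.

(* The intersection of A with the first qU indices, as a set of row indices of
   a matrix with qU rows. *)
Definition tilde (qU r : nat) (A : {set 'I_(qU + r)}) : {set 'I_qU} :=
  [set j : 'I_qU | lshift r j \in A]%SET.

(* Main.v *)
Require Import Defs.
From HB Require Import structures.
From mathcomp Require Import all_boot all_order all_algebra.
From mathcomp Require Import all_classical all_reals all_analysis.
Import Order.TTheory GRing.Theory Num.Theory.
Import numFieldNormedType.Exports.
Local Open Scope classical_set_scope.
Local Open Scope ring_scope.

(** A state x in some region R(A') with A' in M(A) comes with a pair (U, l)
    that satisfies the KKT conditions at x: the multipliers vanish off A', so
    the Lagrangian restricted to A' is the full Lagrangian, and complementarity
    holds since each index has a vanishing multiplier or a vanishing constraint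
    ([region_KKT]). By uniqueness this pair is the KKT solution at x, so U is
    the optimal control law ([KKTsol_eq]).

    Membership of A' in M(A) says that A' and A select the same half-spaces of
    the set that constrains u(0). The half-spaces selected by A are therefore
    active at U, which is a linear system for u(0) with the square matrix of
    the selected rows ([active_input]). At full rank this system determines
    u(0) ([solve_castmx]), independently of x and of A'. *)

(** The cast makes a matrix square whose number of rows is only provably the
    dimension. *)
Lemma solve_castmx {F : fieldType} {k d : nat} (e : k = d) {M : 'M[F]_(k, d)}
    {b : 'cV[F]_k} {v : 'cV[F]_d} :
  \rank M = d -> M *m v = b ->
  v = invmx (castmx (e, erefl d) M) *m castmx (e, erefl 1%N) b.
Proof.
subst k => rankM <-; rewrite !castmx_id mulKmx //.
by rewrite -row_free_unit /row_free rankM.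
Qed.

Section Solution.
Context {R : realType} {n m N qU qX qT q : nat}.
Context {p : ocp R n m N.+1 qU qX qT} {c : 'I_q -> constr N.+1 qU qX qT}.

Lemma region_KKT {A : {set 'I_q}} {x : 'cV[R]_n} :
  region p c A x ->
  exists U l, KKT p c x U l /\ forall i, i \in A -> Gcon p c x U i 0 = 0.
Proof.
move=> [U [l [gradL GA lI GI lA]]]; exists U, l; split=> //; split.
  rewrite -[RHS]gradL; congr grad; apply/funext => z; congr (_ + _).
  rewrite [RHS]big_mkcond; apply: eq_bigr => i _.
  by case: ifPn => // /lI ->; rewrite mul0r.
move=> i; have [iA|iA] := boolP (i \in A).
  by rewrite GA // mulr0 lexx; split=> //; apply: ltW; rewrite -oppr_lt0 lA.
by rewrite lI // mul0r lexx ltW ?GI.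
Qed.

Lemma KKTsol_eq {x : 'cV[R]_n} {U : 'cV[R]_(N.+1 * m)} {l : 'cV[R]_q} :
  KKT_unique p c -> KKT p c x U l -> KKTsol p c x = (U, l).
Proof.
move=> huniq kkt; have kktUl : KKTset p c x (U, l) by [].
by apply: xget_unique => // z /(huniq x (ex_intro _ _ kktUl)); apply.
Qed.

End Solution.

Lemma active_input {R : realType} {n m N qU qX qT r : nat}
    {p : ocp R n m N.+1 qU qX qT} {c : 'I_(qU + r) -> constr N.+1 qU qX qT}
    {A : {set 'I_(qU + r)}} (x : 'cV[R]_n) {U : 'cV[R]_(N.+1 * m)} :
  (forall j : 'I_qU, c (lshift r j) = InputC ord0 j) ->
  (forall j, lshift r j \in A -> Gcon p c x U (lshift r j) 0 = 0) ->
  subrows (tilde A) (GU p) *m input U ord0 = subrows (tilde A) (wU p).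
Proof.
move=> c_first active; rewrite /subrows mul_rowsub_mx; apply/matrixP => i j.
rewrite ord1 [LHS]mxE [RHS]mxE; apply/eqP; rewrite -subr_eq0; apply/eqP.
have := enum_valP i; rewrite inE => /active.
by rewrite mxE c_first /= mxE [X in _ + X]mxE.
Qed.

Theorem proposition3 (R : realType) (n m N qU qX qT r : nat)
    (p : ocp R n m N.+1 qU qX qT)
    (c : 'I_(qU + r) -> constr N.+1 qU qX qT)
    (hp : ocp_ok p)
    (c_bij : bijective c)
    (c_first : forall j : 'I_qU, c (lshift r j) = InputC ord0 j)
    (huniq : KKT_unique p c)
    (A : {set 'I_(qU + r)})
    (hA : exists_active p c A)
    (hcard : #|tilde A| = m)
    (hrank : \rank (subrows (tilde A) (GU p)) = m) :
  forall x : 'cV[R]_n, Gamma p c A x ->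
    Fset p c x /\
    ustar p c x =
      invmx (castmx (hcard, erefl m) (subrows (tilde A) (GU p)))
        *m castmx (hcard, erefl 1%N) (subrows (tilde A) (wU p)).
Proof.
move=> x [A' MA' /region_KKT[U [l [kkt GA']]]].
split; first by exists (U, l).
rewrite /ustar /Ustar (KKTsol_eq huniq kkt) /=.
apply: (solve_castmx hcard hrank).
apply: (active_input x c_first) => j jA; apply: GA'.
have : lshift r j \in A :&: first_rows qU (qU + r) by rewrite !inE jA /=.
by rewrite -MA' inE => /andP[].
Qed.
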